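(* Let $\{P_\ell\}_{\ell=1}^{n!}$ be an enumeration of the set $\mathcal P_n$ of $n\times n$ permutation matrices and, for $A\in\mathcal D_n$, let $\alpha_\ell(A)$, $\ell=1,\dots,n!$, be the coefficients of the continuous Birkhoff decomposition of $A$ induced by this enumeration. Then each $\alpha_\ell:\mathcal D_n\to\mathbb R$ is an almost everywhere differentiable function.
   Context: $\mathcal D_n\subset\mathbb R^{n\times n}$ denotes the Birkhoff polytope, i.e. the set of $n\times n$ doubly stochastic matrices (non-negative entries, every row and every column sums to $1$). It lies in the $(n-1)^2$-dimensional affine subspace of $\mathbb R^{n^2}$ consisting of matrices all of whose row and column sums equal $1$. ''Almost everywhere'' and ''differentiable'' refer to the $(n-1)^2$-dimensional Lebesgue measure on, and differentiability within, this affine subspace. Continuous Birkhoff decomposition: given an enumeration $\{P_\ell\}_{\ell=1}^{n!}$ of $\mathcal P_n$ (a fixed total order on all permutation matrices) and $A\in\mathcal D_n$, the coefficients are defined recursively for $\ell=1,\dots,n!$ by $$\alpha_\ell=\min_{i,j}\Big\{A(i,j)-\sum_{m=1}^{\ell-1}\alpha_mP_m(i,j)\ \Big|\ P_\ell(i,j)=1\Big\}.$$ *)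

(* Defs.v *)
From mathcomp Require Import perm.
From mathcomp Require Export all_boot all_order all_algebra.
From mathcomp Require Export all_classical all_reals all_analysis.
Set Implicit Arguments.
Unset Strict Implicit.
Unset Printing Implicit Defensive.
Import Order.TTheory GRing.Theory Num.Theory.
Import numFieldNormedType.Exports.
Local Open Scope classical_set_scope.
Local Open Scope ring_scope.

Section Birkhoff_polytope.
Variables (R : realType) (n : nat).

Definition unit_line_sums : set 'M[R]_n :=
  [set A : 'M[R]_n | (forall i, \sum_j A i j = 1) /\ (forall j, \sum_i A i j = 1)].

Definition birkhoff_polytope : set 'M[R]_n :=
  [set A : 'M[R]_n | (forall i j, 0 <= A i j) /\ unit_line_sums A].

End Birkhoff_polytope.
Arguments unit_line_sums {R n}.
Arguments birkhoff_polytope {R n}.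

(* The sequence P is meant to be used with P 0, ..., P (n`! - 1) enumerating
   the permutation matrices; indices start at 0. *)
Section Birkhoff_decomposition.
Variables (R : realType) (n : nat).
Implicit Types (P : nat -> 'M[R]_n) (A Q S : 'M[R]_n).

(* When S is a permutation matrix of positive size, the infimum is over a
   finite nonempty set, hence is a minimum; see birkhoff_coef_min. *)
Definition support_min S Q : R :=
  inf [set x | exists i j, S i j = 1 /\ x = Q i j].

Fixpoint birkhoff_residual P A l : 'M[R]_n :=
  if l is l'.+1 then
    let Q := birkhoff_residual P A l' in Q - support_min (P l') Q *: P l'
  else A.

Definition birkhoff_coef P A l : R :=
  support_min (P l) (birkhoff_residual P A l).

Lemma birkhoff_residualE P A l :
  birkhoff_residual P A l = A - \sum_(m < l) birkhoff_coef P A m *: P m.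
Proof.
elim: l => [|l IH]; first by rewrite big_ord0 subr0.
by rewrite big_ord_recr /= opprD addrA -IH.
Qed.

End Birkhoff_decomposition.

Lemma birkhoff_coef_min (R : realType) (n : nat) (P : nat -> 'M[R]_n.+1)
    (A : 'M[R]_n.+1) (l : nat) (hP : is_perm_mx (P l)) :
  let F i j := A i j - \sum_(m < l) birkhoff_coef P A m * P m i j in
  (exists i j, P l i j = 1 /\ birkhoff_coef P A l = F i j) /\
  (forall i j, P l i j = 1 -> birkhoff_coef P A l <= F i j).
Proof.
move=> F.
have FE i j : birkhoff_residual P A l i j = F i j.
  rewrite birkhoff_residualE !mxE summxE; congr (_ - _).
  by apply: eq_bigr => m _; rewrite !mxE.
have [s Ps] := is_perm_mxP _ hP.
have PE i j : P l i j = 1 <-> j = s i.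
  rewrite Ps !mxE; split=> [|->]; last by rewrite eqxx.
  by case: eqP => [->//|_] /eqP; rewrite eq_sym oner_eq0.
have [i0 _ hi0] := @arg_minP _ _ _ (ord0 : 'I_n.+1) xpredT
  (fun i => F i (s i)) isT.
have lb : lbound [set x | exists i j, P l i j = 1 /\
    x = birkhoff_residual P A l i j] (F i0 (s i0)).
  by move=> _ [i [j [/PE -> ->]]]; rewrite FE; exact: hi0.
suff E : birkhoff_coef P A l = F i0 (s i0).
  split; first by exists i0, (s i0); split=> //; exact/PE.
  by move=> i j /PE ->; rewrite E; exact: hi0.
apply/eqP; rewrite eq_le; apply/andP; split.
  apply: ge_inf; first by exists (F i0 (s i0)).
  by exists i0, (s i0); split; [exact/PE | rewrite FE].
apply: lb_le_inf => //.
by exists (F i0 (s i0)); exists i0, (s i0); split; [exact/PE | rewrite FE].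
Qed.

Section Lebesgue_outer_measure.
Variables (R : realType) (m n : nat).

Definition box (a b : 'M[R]_(m, n)) : set 'M[R]_(m, n) :=
  [set X : 'M[R]_(m, n) | forall i j, a i j <= X i j <= b i j].

Definition box_volume (a b : 'M[R]_(m, n)) : R :=
  \prod_i \prod_j (b i j - a i j).

(* Finite covers are allowed (through the index predicate I) because in
   dimension 0 every box is the whole one-point space, of volume 1. *)
Definition lebesgue_outer (N : set 'M[R]_(m, n)) : \bar R :=
  ereal_inf [set v | exists (I : pred nat) (a b : nat -> 'M[R]_(m, n)),
    [/\ forall k i j, a k i j <= b k i j,
        N `<=` \bigcup_(k in [set k | I k]) box (a k) (b k) &
        v = (\sum_(0 <= k <oo | I k) (box_volume (a k) (b k))%:E)%E]].

End Lebesgue_outer_measure.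

(* Matrices of size n.+1 with unit line sums form an affine space of dimension
   n * n, parametrized by their lower right n x n block. Null sets and
   differentiability do not depend on the choice of affine coordinates: two
   choices differ by an invertible affine map, which multiplies Lebesgue
   measure by a positive constant. *)
Section Affine_coordinates.
Variables (R : realType) (n : nat).

Definition chart (M : 'M[R]_n) : 'M[R]_n.+1 :=
  block_mx (1 - \sum_j (1 - \sum_i M i j))%:M (\row_j (1 - \sum_i M i j))
           (\col_i (1 - \sum_j M i j))        M.

Definition coords (A : 'M[R]_n.+1) : 'M[R]_n := @drsubmx R 1 n 1 n A.

Lemma chartK : cancel chart coords.
Proof. by move=> M; rewrite /coords /chart block_mxKdr. Qed.

Lemma chart_unit_line_sums M : unit_line_sums (chart M).
Proof.
have E : \sum_j (1 - \sum_i M i j) = \sum_i (1 - \sum_j M i j).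
  by rewrite !sumrB exchange_big.
have ul (a b : 'I_1) : chart M (lshift n a) (lshift n b) =
    1 - \sum_j (1 - \sum_i M i j).
  by rewrite [LHS]block_mxEul !mxE !ord1 eqxx mulr1n.
have ur (a : 'I_1) j : chart M (lshift n a) (rshift 1 j) = 1 - \sum_i M i j.
  by rewrite [LHS]block_mxEur mxE.
have dl i (b : 'I_1) : chart M (rshift 1 i) (lshift n b) = 1 - \sum_j M i j.
  by rewrite [LHS]block_mxEdl mxE.
have dr i j : chart M (rshift 1 i) (rshift 1 j) = M i j.
  by rewrite [LHS]block_mxEdr.
split=> i; rewrite (@big_split_ord _ _ _ 1 n) big_ord1 /=;
  case: (@splitP 1 n i) => k ik.
- have -> : i = lshift n k by exact/val_inj.
  by under eq_bigr do rewrite ur; rewrite ul subrK.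
- have -> : i = rshift 1 k by exact/val_inj.
  by under eq_bigr do rewrite dr; rewrite dl subrK.
- have -> : i = lshift n k by exact/val_inj.
  by under eq_bigr do rewrite dl; rewrite ul E subrK.
- have -> : i = rshift 1 k by exact/val_inj.
  by under eq_bigr do rewrite dr; rewrite ur subrK.
Qed.

Lemma coordsK A : unit_line_sums A -> chart (coords A) = A.
Proof.
move=> [hr hc].
have hrow i : A i (lshift n 0 : 'I_(1 + n)) = 1 - \sum_j A i (rshift 1 j).
  apply/eqP; rewrite eq_sym subr_eq -(hr i) (@big_split_ord _ _ _ 1 n).
  by rewrite big_ord1.
have hcol j : A (lshift n 0 : 'I_(1 + n)) j = 1 - \sum_i A (rshift 1 i) j.
  apply/eqP; rewrite eq_sym subr_eq -(hc j) (@big_split_ord _ _ _ 1 n).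
  by rewrite big_ord1.
apply: etrans _ (@submxK _ 1 n 1 n A).
congr (@block_mx R 1 n 1 n _ _ _ _);
  apply/matrixP => i j; rewrite ?(ord1 i) ?(ord1 j) !mxE.
- rewrite eqxx mulr1n hrow; congr (1 - _); apply: eq_bigr => k _.
  by rewrite hcol; congr (1 - _); apply: eq_bigr => k' _; rewrite !mxE.
- by rewrite hcol; congr (1 - _); apply: eq_bigr => k _; rewrite !mxE.
- by rewrite hrow; congr (1 - _); apply: eq_bigr => k _; rewrite !mxE.
Qed.

Lemma chart_bij : set_bij setT unit_line_sums chart.
Proof.
split.
- by move=> M _; exact: chart_unit_line_sums.
- by move=> M N _ _; exact: (can_inj chartK).
- by move=> A hA; exists (coords A) => //; exact: coordsK.
Qed.

Definition affine_null (N : set 'M[R]_n.+1) : Prop :=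
  lebesgue_outer (chart @^-1` N) = 0%E.

(* A must be interior to D relative to the affine space, so that only the
   values of f on D matter. *)
Definition differentiable_in (D : set 'M[R]_n.+1) (f : 'M[R]_n.+1 -> R)
    (A : 'M[R]_n.+1) : Prop :=
  interior (chart @^-1` D) (coords A) /\
  differentiable (f \o chart : 'M[R]_n -> R) (coords A).

Definition ae_differentiable_on (D : set 'M[R]_n.+1) (f : 'M[R]_n.+1 -> R) :=
  affine_null [set A | D A /\ ~ differentiable_in D f A].

End Affine_coordinates.

(* Main.v *)
(* The coefficients are built from the matrix entries by differences, scalings
   and finite minima, so in the chart each of them is a continuous function
   selected pointwise from finitely many affine functions. Off the hyperplanes
   where two distinct selections agree, such a function is locally affine. The
   relative boundary of the polytope lies in the hyperplanes where an entry
   vanishes. A hyperplane is null: within a cube, subdividing the coordinates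
   other than one pivot coordinate into cells of side h covers it by boxes of
   height O(h), of total volume O(h). *)
Require Import Defs.
From mathcomp Require Import perm.
From mathcomp Require Import all_boot all_order all_algebra.
From mathcomp Require Import all_classical all_reals all_analysis.
From mathcomp Require Import ring lra.
Import Order.TTheory GRing.Theory Num.Theory.
Import numFieldNormedType.Exports.
Local Open Scope classical_set_scope.
Local Open Scope ring_scope.

(** * Null sets of the outer measure by boxes *)

Section Outer_measure.
Context {R : realType} {m n : nat}.
Implicit Types (N : set 'M[R]_(m, n)) (a b : 'M[R]_(m, n)).

Lemma box_volume_ge0 a b : (forall i j, a i j <= b i j) -> 0 <= box_volume a b.
Proof.
by move=> ab; apply: prodr_ge0 => i _; apply: prodr_ge0 => j _; rewrite subr_ge0.
Qed.

Lemma lebesgue_outer_ge0 N : (0 <= lebesgue_outer N)%E.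
Proof.
apply: le_ereal_inf_tmp => _ [I [a [b [ab _ ->]]]].
by apply: nneseries_ge0 => k _ _; rewrite lee_fin box_volume_ge0.
Qed.

(** Encoding [T] into [nat] by [pickle] lets covers be indexed by any convenient countable type:
    pairs for countable unions, grid cells for hyperplanes. *)
Lemma lebesgue_outer_le_esum (T : countType) (D : set T)
    (a b : T -> 'M[R]_(m, n)) N :
  (forall t i j, D t -> a t i j <= b t i j) ->
  N `<=` \bigcup_(t in D) box (a t) (b t) ->
  (lebesgue_outer N <= \esum_(t in D) (box_volume (a t) (b t))%:E)%E.
Proof.
move=> ab Nab.
(* Other indices get the degenerate box at 0, to keep the corners ordered; [I] discards them, since
   in dimension 0 even that box has volume 1. *)
pose at_ (c : T -> 'M[R]_(m, n)) k :=
  if @pickle_inv T k is Some t then if t \in D then c t else 0 else 0.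
pose I k := if @pickle_inv T k is Some t then t \in D else false.
have atE c t : D t -> at_ c (pickle t) = c t.
  by move=> Dt; rewrite /at_ pickleK_inv mem_set.
have ab_ k i j : at_ a k i j <= at_ b k i j.
  rewrite /at_; case: (@pickle_inv T k) => [t|//].
  by case: ifPn => // /set_mem /ab.
apply: ereal_inf_lbound; exists I, (at_ a), (at_ b); split => //.
  move=> x /Nab [t Dt xt]; exists (pickle t); last by rewrite !atE.
  by rewrite /= /I pickleK_inv mem_set.
rewrite nneseries_esum; last by move=> k _; rewrite lee_fin box_volume_ge0.
rewrite (@reindex_esum _ _ _ D _ pickle).
  by apply: eq_esum => t Dt; rewrite !atE.
split.
- by move=> t Dt; rewrite /= /I pickleK_inv mem_set.
- by move=> s t _ _ /(pcan_inj (@pickleK_inv _)).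
- move=> k /=; rewrite /I; case E : (@pickle_inv T k) => [t|//] /set_mem Dt.
  by exists t => //; have := @pickle_invK T k; rewrite E.
Qed.

Lemma lebesgue_outer_eq0 N :
  (forall e : R, 0 < e -> (lebesgue_outer N <= e%:E)%E) -> lebesgue_outer N = 0%E.
Proof.
move=> h; apply/eqP; rewrite eq_le lebesgue_outer_ge0 andbT.
by apply/lee_addgt0Pr => e e0; rewrite add0e h.
Qed.

Lemma lebesgue_outer_null_sub {N} M :
  N `<=` M -> lebesgue_outer M = 0%E -> lebesgue_outer N = 0%E.
Proof.
move=> NM M0; apply/eqP; rewrite eq_le lebesgue_outer_ge0 andbT -M0.
apply: ereal_inf_le_tmp => _ [I [a [b [ab Mab ->]]]].
by exists I, a, b; split => //; apply: subset_trans Mab.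
Qed.

(** Covering [N k] at cost at most [e / 2 ^ k.+1] and merging the covers, indexed by pairs, costs at
    most [e] in total. *)
Lemma lebesgue_outer_bigcup_null (N : nat -> set 'M[R]_(m, n)) :
  (forall k, lebesgue_outer (N k) = 0%E) -> lebesgue_outer (\bigcup_k N k) = 0%E.
Proof.
move=> N0; apply: lebesgue_outer_eq0 => e e0.
have cover k : exists c : pred nat * (nat -> 'M[R]_(m, n)) * (nat -> 'M[R]_(m, n)),
    [/\ forall l i j, c.1.2 l i j <= c.2 l i j,
      N k `<=` \bigcup_(l in [set l | c.1.1 l]) box (c.1.2 l) (c.2 l) &
      (\esum_(l in [set l | c.1.1 l]) (box_volume (c.1.2 l) (c.2 l))%:E <=
        (e / (2 ^ k.+1)%:R)%:E)%E].
  have /ereal_inf_lt[_ [I [a [b [ab Nab ->]]]] lt_e] :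
      (lebesgue_outer (N k) < (e / (2 ^ k.+1)%:R)%:E)%E.
    by rewrite N0 lte_fin divr_gt0// ltr0n expn_gt0.
  exists (I, a, b); split => //=; apply: le_trans (ltW lt_e).
  by rewrite nneseries_esum// => l _; rewrite lee_fin box_volume_ge0.
have [c hc] := choice cover.
apply: le_trans (@lebesgue_outer_le_esum (nat * nat)%type
  (setT `*`` (fun k => [set l | (c k).1.1 l]))
  (fun p => (c p.1).1.2 p.2) (fun p => (c p.1).2 p.2) _ _ _) _.
- by move=> [k l] i j _; have [+ _ _] := hc k; exact.
- move=> x [k _ xk]; have [_ /(_ _ xk)[l Il xl] _] := hc k.
  by exists (k, l).
rewrite -(@esum_esum _ _ _ setT (fun k => [set l | (c k).1.1 l])
  (fun k l => (box_volume ((c k).1.2 l) ((c k).2 l))%:E)); last first.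
  by move=> k l _ _; have [ab _ _] := hc k; rewrite lee_fin box_volume_ge0.
apply: le_trans (epsilon_trick0 xpredT (ltW e0)).
rewrite nneseries_esumT; last first.
  by move=> k; rewrite lee_fin divr_ge0 ?ler0n// ltW.
by apply: le_esum => k _; have [_ _] := hc k.
Qed.

Lemma lebesgue_outer_le_sum (T : finType) (a b : T -> 'M[R]_(m, n)) N :
  (forall t i j, a t i j <= b t i j) ->
  N `<=` \bigcup_t box (a t) (b t) ->
  (lebesgue_outer N <= (\sum_t box_volume (a t) (b t))%:E)%E.
Proof.
move=> ab Nab.
apply: le_trans (@lebesgue_outer_le_esum T setT a b N _ Nab) _.
  by move=> t i j _; exact: ab.
rewrite esum_fset; first last.
- by move=> t _; rewrite lee_fin box_volume_ge0.
- exact: finite_finset.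
rewrite (_ : setT = [set` index_enum T]); last first.
  by apply/seteqP; split => t //= _; rewrite mem_index_enum.
by rewrite -fsbig_seq ?index_enum_uniq// sumEFin.
Qed.

End Outer_measure.

(** * Zero sets of affine functions *)

(** An affine function is stored as its pair of coefficients: differences are taken in a module, and
    being non-zero is a condition on the pair. *)
Definition affine_eval {R : realType} {m n : nat} (g : R * 'M[R]_(m, n))
    (x : 'M[R]_(m, n)) : R :=
  g.1 + \sum_(p : 'I_m * 'I_n) g.2 p.1 p.2 * x p.1 p.2.

Lemma grid_cell {R : realType} (N : nat) (h y : R) :
  0 <= y <= h * N.+1%:R -> exists k : 'I_N.+1, h * k%:R <= y <= h * k%:R + h.
Proof.
elim: N => [|N IH] /andP[y0 yN].
  by exists ord0; rewrite /= mulr0 y0 add0r -[leRHS]mulr1.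
have [yN1|/ltW yN1] := leP y (h * N.+1%:R).
  by have [|k hk] := IH; [rewrite y0 | exists (widen_ord (leqnSn _) k)].
by exists ord_max; rewrite /= yN1 /= -[X in _ + X]mulr1 -mulrDr natr1.
Qed.

Section Hyperplane.
Context {R : realType} {m n : nat}.
Implicit Types (c K h : R) (B x : 'M[R]_(m, n)).

(** On the hyperplane the pivot coordinate is a Lipschitz function of the others, with constant at
    most [L] for the max norm. Over a cell of side [h] it thus stays within [L * h] of its value
    [center] at the lower corner. *)
Lemma hyperplane_cube_null c B i0 j0 K : B i0 j0 != 0 -> 0 <= K ->
  lebesgue_outer [set x : 'M[R]_(m, n) |
    affine_eval (c, B) x = 0 /\ forall i j, `|x i j| <= K] = 0%E.
Proof.
move=> B0 K0; apply: lebesgue_outer_eq0 => e e0.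
pose p0 := (i0, j0).
pose L := \sum_(p : 'I_m * 'I_n) `|B p.1 p.2| / `|B i0 j0|.
have L0 : 0 <= L by apply: sumr_ge0 => p _; rewrite divr_ge0.
(* [V * h] will be the total volume: height [2 * L * h] over a base cube of side [2 * K]. The choice
   of [N] makes it at most [e]. *)
pose V := 2 * L * \prod_(p : 'I_m * 'I_n | p != p0) (2 * K).
have V0 : 0 <= V.
  by apply: mulr_ge0; [rewrite mulr_ge0 | apply: prodr_ge0 => p _; rewrite mulr_ge0].
pose N := Num.bound (V * (2 * K) / e).
pose h := 2 * K / N.+1%:R.
have h0 : 0 <= h by rewrite divr_ge0// mulr_ge0.
have hN : h * N.+1%:R = 2 * K by rewrite divfK// pnatr_eq0.
have Vh : V * h <= e.
  rewrite /h mulrA ler_pdivrMr ?ltr0n// [e * _]mulrC -ler_pdivrMr//.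
  apply: ltW; apply: (lt_trans (archi_boundP _)); last by rewrite ltr_nat.
  by apply: divr_ge0; [apply: mulr_ge0 => //; rewrite mulr_ge0 | exact: ltW].
(* With pivot entry 0, evaluation at [corner] leaves only the other terms, so [center] is the pivot
   value that solves the equation there. *)
pose corner (f : {ffun 'I_m * 'I_n -> 'I_N.+1}) : 'M[R]_(m, n) :=
  \matrix_(i, j) if (i, j) == p0 then 0 else - K + h * (f (i, j))%:R.
pose center (f : {ffun 'I_m * 'I_n -> 'I_N.+1}) := - affine_eval (c, B) (corner f) / B i0 j0.
pose a (f : {ffun 'I_m * 'I_n -> 'I_N.+1}) : 'M[R]_(m, n) := \matrix_(i, j)
  if (i, j) == p0 then if f p0 == ord0 then center f - L * h else 0
  else - K + h * (f (i, j))%:R.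
pose b (f : {ffun 'I_m * 'I_n -> 'I_N.+1}) : 'M[R]_(m, n) := \matrix_(i, j)
  if (i, j) == p0 then if f p0 == ord0 then center f + L * h else 0
  else - K + h * (f (i, j))%:R + h.
have Lh0 : 0 <= L * h by rewrite mulr_ge0.
(* The pivot has N.+1 cells too; all but the first get height 0, so that the
   total volume factors as a product of sums. *)
pose w p (k : 'I_N.+1) :=
  if p == p0 then if k == ord0 then 2 * L * h else 0 else h.
have volE f : box_volume (a f) (b f) = \prod_p w p (f p).
  rewrite /box_volume pair_big /=; apply: eq_bigr => -[i j] _ /=.
  rewrite !mxE /w; case: eqP => [->|_]; last by rewrite addrC addKr.
  by case: ifP => _; ring.
have sum_vol : \sum_f box_volume (a f) (b f) = V * h.
  under eq_bigr do rewrite volE.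
  rewrite -(bigA_distr_bigA w) (bigD1 p0)//= {1}/w eqxx -big_mkcond big_pred1_eq.
  rewrite /V [RHS]mulrAC; congr (_ * _); apply: eq_bigr => p /negbTE p_neq.
  by rewrite /w p_neq sumr_const card_ord -[h *+ _]mulr_natr.
apply: le_trans (@lebesgue_outer_le_sum _ _ _ _ a b _ _ _) _.
- move=> f i j; rewrite !mxE; case: ifP => _; last by rewrite lerDl.
  by case: ifP => _ //; lra.
- move=> x [x0 xK].
  have cell (p : 'I_m * 'I_n) : exists k : 'I_N.+1,
      h * k%:R <= x p.1 p.2 + K <= h * k%:R + h.
    apply: grid_cell; rewrite hN.
    by have := xK p.1 p.2; rewrite ler_norml; lra.
  have [k hk] := choice cell.
  (* The pivot index has to be [ord0]: the others carry the boxes of height 0. *)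
  pose f := [ffun p => if p == p0 then ord0 else k p].
  exists f => // i j; rewrite !mxE.
  case: eqP => [[-> ->]|/eqP ij]; last first.
    by rewrite ffunE (negbTE ij); have := hk (i, j) => /=; lra.
  rewrite !ffunE !eqxx.
  suff : `|x i0 j0 - center f| <= L * h by rewrite ler_norml; lra.
  rewrite /center mulNr opprK.
  (* The deviation of the pivot is a combination of the other displacements from the corner, each at
     most [h] in absolute value. *)
  have -> : x i0 j0 + affine_eval (c, B) (corner f) / B i0 j0 =
      \sum_(p | p != p0) (B p.1 p.2 / B i0 j0) * (corner f p.1 p.2 - x p.1 p.2).
    move: x0; rewrite /affine_eval /= (bigD1 p0)//= => x0.
    have x0E : x i0 j0 = - (c + \sum_(p | p != p0) B p.1 p.2 * x p.1 p.2) / B i0 j0.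
      apply: (mulIf B0); rewrite divfK//; lra.
    rewrite (bigD1 p0)//= mxE eqxx mulr0 add0r x0E -mulrDl opprD addrACA.
    rewrite addNr add0r addrC -sumrB mulr_suml.
    by apply: eq_bigr => p _; ring.
  rewrite /L mulr_suml [leRHS](bigD1 p0)//=.
  apply: le_trans (ler_norm_sum _ _ _) _.
  apply: ler_wpDl; first by rewrite mulr_ge0// divr_ge0.
  apply: ler_sum => p p_neq; rewrite normrM normf_div ler_wpM2l ?divr_ge0//.
  rewrite ler_norml mxE -surjective_pairing (negbTE p_neq) ffunE (negbTE p_neq).
  by have := hk p; lra.
- by rewrite sum_vol lee_fin.
Qed.

(** If the linear part vanishes, the constant does not, and the zero set is empty, covered by no
    box. Otherwise the zero set is exhausted by its parts in the cubes of radius [k]. *)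
Lemma affine_zeros_null (g : R * 'M[R]_(m, n)) : g != 0 ->
  lebesgue_outer [set x | affine_eval g x = 0] = 0%E.
Proof.
case: g => c B g0.
have [B0|/matrix0Pn[i0 [j0 B0]]] := eqVneq B 0.
  apply: lebesgue_outer_eq0 => e e0.
  apply: le_trans (@lebesgue_outer_le_sum _ _ _ 'I_0 (fun=> 0) (fun=> 0) _ _ _) _.
  - by move=> [].
  - move=> x /=; rewrite /affine_eval /= B0 big1 ?addr0 => [c0|p _].
      by move: g0; rewrite c0 B0 eqxx.
    by rewrite mxE mul0r.
  - by rewrite big_ord0 lee_fin ltW.
apply: lebesgue_outer_null_sub (@lebesgue_outer_bigcup_null _ _ _ (fun k => _)
  (fun k => hyperplane_cube_null c B i0 j0 k%:R B0 (ler0n _ _))).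
move=> x x0; exists (Num.bound (\sum_i \sum_j `|x i j|)) => //; split => // i j.
apply: ltW; apply: le_lt_trans (archi_boundP _); last first.
  by do 2![apply: sumr_ge0 => ? _].
rewrite (bigD1 i)//= (bigD1 j)//= -addrA lerDl addr_ge0 ?sumr_ge0// => k _.
by rewrite sumr_ge0.
Qed.

End Hyperplane.

(** * Differentiability depends only on the germ *)

Lemma differentiable_near0 {R : numFieldType} {V W : normedModType R} (z : V -> W) (x : V) :
  (\forall y \near x, z y = 0) -> differentiable z x.
Proof.
move=> z0.
have zx : z x = 0 by exact: nbhs_singleton z0.
(* The increment of [z] vanishes identically near 0, so it is [o(id)] with the zero map as
   differential. *)
have zo : z \o shift x = cst (z x) + \0 +o_0 id.
  apply/eqaddoP => e e0.
  have : \forall y \near (0 : V), z (y + x) = 0.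
    by move: z0; rewrite (near_shift 0) subr0.
  apply: filterS => y zy.
  rewrite /= !fctE /= zy zx /= addr0 subrr normr0 mulr_ge0// ltW//.
have zE : 'd z x = \0 :> (V -> W).
  by apply: (@diff_unique _ _ _ z \0 x) => //; exact: cst_continuous.
by apply/diff_locallyP; rewrite zE; split => //; exact: cst_continuous.
Qed.
Lemma near_eq_differentiable {R : numFieldType} {V W : normedModType R} (f g : V -> W) (x : V) :
  (\forall y \near x, f y = g y) -> differentiable g x -> differentiable f x.
Proof.
move=> fg dg; rewrite (_ : f = g + (f - g)); last by rewrite addrC subrK.
apply: differentiableD => //; apply: differentiable_near0.
by apply: filterS fg => y fgy; rewrite fctE fgy subrr.
Qed.

(** * Affine functions and continuous selections from them *)

Section Affine_functions.
Context {R : realType} {m n : nat}.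
Implicit Types (g : R * 'M[R]_(m, n)) (x : 'M[R]_(m, n)) (f : 'M[R]_(m, n) -> R).

Lemma affine_evalD g1 g2 x :
  affine_eval (g1 + g2) x = affine_eval g1 x + affine_eval g2 x.
Proof.
rewrite /affine_eval addrACA -big_split /=; congr (_ + _).
by apply: eq_bigr => p _; rewrite mxE mulrDl.
Qed.

Lemma affine_evalZ a g x : affine_eval (a *: g) x = a * affine_eval g x.
Proof.
rewrite /affine_eval mulrDr mulr_sumr /=; congr (_ + _).
by apply: eq_bigr => p _; rewrite mxE mulrA.
Qed.

Lemma affine_evalB g1 g2 x :
  affine_eval (g1 - g2) x = affine_eval g1 x - affine_eval g2 x.
Proof. by rewrite affine_evalD -scaleN1r affine_evalZ mulN1r. Qed.

Lemma differentiable_affine_eval g x : differentiable (affine_eval g : _ -> R) x.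
Proof.
rewrite (_ : affine_eval g = cst g.1 +
    \sum_(i < #|{: 'I_m * 'I_n}|) (fun y : 'M[R]_(m, n) =>
      g.2 (enum_val i).1 (enum_val i).2 * y (enum_val i).1 (enum_val i).2)).
  apply: differentiableD => //; apply: differentiable_sum => i.
  exact: differentiableZ (differentiable_coord _ _ _).
apply/funext => y; rewrite fctE fct_sumE /affine_eval; congr (_ + _).
by rewrite (reindex (@enum_val ('I_m * 'I_n)%type predT)) //; apply: onW_bij; exact: enum_val_bij.
Qed.

Lemma continuous_affine_eval g : continuous (affine_eval g).
Proof.
by move=> x; apply: differentiable_continuous; exact: differentiable_affine_eval.
Qed.

Definition is_affine f := exists g, f =1 affine_eval g.

Lemma is_affine_cst (c : R) : is_affine (fun=> c).
Proof.
exists (c, 0) => x; rewrite /affine_eval big1 ?addr0// => p _.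
by rewrite mxE mul0r.
Qed.

Lemma is_affine_coord i j : is_affine (fun x => x i j).
Proof.
exists (0, delta_mx i j) => x; rewrite /affine_eval add0r (bigD1 (i, j))//=.
rewrite mxE !eqxx mul1r big1 ?addr0// => -[i' j'] /negbTE ij.
by rewrite mxE -xpair_eqE ij mul0r.
Qed.

Lemma is_affineB f1 f2 :
  is_affine f1 -> is_affine f2 -> is_affine (fun x => f1 x - f2 x).
Proof.
by move=> [g1 f1E] [g2 f2E]; exists (g1 - g2) => x; rewrite f1E f2E affine_evalB.
Qed.

Lemma is_affine_sum (I : Type) (r : seq I) (F : I -> 'M[R]_(m, n) -> R) :
  (forall i, is_affine (F i)) -> is_affine (fun x => \sum_(i <- r) F i x).
Proof.
move=> FA; elim: r => [|i r [g gE]].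
  by have [g gE] := is_affine_cst 0; exists g => x; rewrite big_nil -gE.
by have [g' g'E] := FA i; exists (g' + g) => x; rewrite big_cons affine_evalD gE g'E.
Qed.

(* A continuous function each of whose values agrees with one of finitely many
   affine functions; no polyhedral cell structure is recorded. *)
Definition piecewise_affine f := continuous f /\
  exists s : seq (R * 'M[R]_(m, n)), forall x, exists2 g, g \in s & f x = affine_eval g x.

Lemma is_affine_piecewise f : is_affine f -> piecewise_affine f.
Proof.
move=> [g fE]; split; first by rewrite (funext fE); exact: continuous_affine_eval.
by exists [:: g] => x; exists g; rewrite ?mem_head.
Qed.

(** This is one step of the residual recursion read in a fixed entry, [a] being that entry of the
    permutation matrix. *)
Lemma piecewise_affine_subZ f1 f2 a : piecewise_affine f1 -> piecewise_affine f2 ->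
  piecewise_affine (fun x => f1 x - f2 x * a).
Proof.
move=> [f1c [s1 f1s]] [f2c [s2 f2s]]; split.
  move=> x; apply: (@continuousB _ _ _ f1 (fun y => f2 y * a)); first exact: f1c.
  by apply: continuousM; [exact: f2c | exact: cst_continuous].
exists [seq g1 - a *: g2 | g1 <- s1, g2 <- s2] => x.
have [g1 g1s ->] := f1s x; have [g2 g2s ->] := f2s x.
exists (g1 - a *: g2); first exact: allpairs_f.
by rewrite affine_evalB affine_evalZ mulrC.
Qed.

(** [f] is given as an attained lower bound, the form in which [birkhoff_coef_min] describes a
    coefficient. *)
Lemma piecewise_affine_min (k : nat) (F : 'I_k.+1 -> 'M[R]_(m, n) -> R) f :
  (forall i, piecewise_affine (F i)) ->
  (forall x, (exists i, f x = F i x) /\ (forall i, f x <= F i x)) ->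
  piecewise_affine f.
Proof.
move=> FA fF; split.
  (* The initial value [F ord0] belongs to the family, so it does not alter the minimum. *)
  have -> : f = fun x => \big[Order.min/F ord0 x]_i F i x.
    apply/funext => x; have [[i fi] f_le] := fF x.
    apply/eqP; rewrite eq_le; apply/andP; split.
      by apply: le_bigmin => // j _.
    by rewrite fi; apply: bigmin_le_cond.
  elim: (index_enum _) => [|i r IH].
    rewrite (_ : (fun _ => _) = F ord0); first by have [] := FA ord0.
    by apply/funext => x; rewrite big_nil.
  rewrite (_ : (fun _ => _) = (F i) \min (fun x => \big[Order.min/F ord0 x]_(i <- r) F i x)).
    by move=> x; apply: continuous_min; [have [+ _] := FA i; exact | exact: IH].
  by apply/funext => x; rewrite big_cons.
have [s hs] := choice (fun i => (FA i).2).
exists (flatten [seq s i | i : 'I_k.+1]) => x.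
have [[i ->] _] := fF x; have [g gs FE] := hs i x; exists g => //.
by apply/flatten_mapP; exists i; rewrite ?mem_enum.
Qed.

(* Off the hyperplanes where two distinct affine pieces agree, continuity forces
   f to follow a single piece near x. *)
Lemma piecewise_affine_differentiable f : piecewise_affine f ->
  exists2 s : seq (R * 'M[R]_(m, n)), 0 \notin s &
    forall x, (forall g, g \in s -> affine_eval g x != 0) -> differentiable f x.
Proof.
move=> [fc [s fs]].
exists [seq d <- [seq g1 - g2 | g1 <- s, g2 <- s] | d != 0].
  by rewrite mem_filter eqxx.
move=> x hx; have [g gs fxE] := fs x.
suff : \forall y \near x, f y = affine_eval g y.
  move=> /near_eq_differentiable; apply; exact: differentiable_affine_eval.
(* A piece that differs from [f] at [x] still differs from it nearby; so any piece that [f] follows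
   close to [x] already equals [f] at [x]. *)
have sep (r : seq (R * 'M[R]_(m, n))) : \forall y \near x,
    all (fun g' => (affine_eval g' x != f x) ==> (affine_eval g' y != f y)) r.
  elim: r => [|g' r IH]; first by apply: filterS filterT.
  have [g'x|g'x] := eqVneq (affine_eval g' x) (f x).
    by apply: filterS IH => y /= ->; rewrite g'x eqxx.
  have dc : {for x, continuous (affine_eval g' - f)}.
    by apply: continuousB; [exact: continuous_affine_eval | exact: fc].
  have d0 : (affine_eval g' - f) x != 0 by rewrite subr_eq0.
  apply: filterS2 (cvgr_neq0 _ dc d0) IH => y /= + ->.
  by rewrite subr_eq0 => ->; rewrite implybT.
apply: filterS (sep s) => y /allP sy.
have [g' g's fyE] := fs y.
have := sy _ g's; rewrite -fyE eqxx implybF negbK fxE => /eqP g'x.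
(* Both pieces take the value [f x] at [x]; were they distinct, their difference would be a listed
   function vanishing there. *)
suff -> : g = g' by [].
apply/eqP; apply/negPn/negP => gg'.
have /hx : g' - g \in [seq d <- [seq g1 - g2 | g1 <- s, g2 <- s] | d != 0].
  rewrite mem_filter subr_eq0 eq_sym gg' /=.
  exact: (allpairs_f (fun g1 g2 => g1 - g2)).
by rewrite affine_evalB g'x subrr eqxx.
Qed.

Lemma affine_zeros_seq_null (s : seq (R * 'M[R]_(m, n))) : 0 \notin s ->
  lebesgue_outer [set x | exists2 g, g \in s & affine_eval g x = 0] = 0%E.
Proof.
move=> s0; pose N k := [set x | (k < size s)%N /\ affine_eval s`_k x = 0].
apply: lebesgue_outer_null_sub (@lebesgue_outer_bigcup_null _ _ _ N _).
  by move=> x [g /(nthP 0)[k ks <-] gx]; exists k.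
move=> k; have [ks|ks] := ltnP k (size s); last first.
  (* Past the end of the list the set is empty, hence inside the zero set of the constant 1. *)
  apply: lebesgue_outer_null_sub (affine_zeros_null (1, 0) _).
    by move=> x [+ _]; rewrite ltnNge ks.
  by rewrite -pair_eqE /= negb_and oner_eq0.
apply: lebesgue_outer_null_sub (affine_zeros_null s`_k _); first by move=> x [].
by apply: contraNneq s0 => <-; exact: mem_nth.
Qed.

End Affine_functions.

(** * Matrix entries and Birkhoff coefficients in the chart *)

Section Chart.
Context {R : realType} {n : nat}.

Lemma is_affine_chart i j : is_affine (fun M : 'M[R]_n => chart M i j).
Proof.
have sum_coords (F : 'I_n -> 'M[R]_n -> R) :
    (forall i, is_affine (F i)) -> is_affine (fun M => 1 - \sum_i F i M).
  by move=> FA; apply: is_affineB; [exact: is_affine_cst | exact: is_affine_sum].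
suff [f fA fE] : exists2 f, is_affine f & forall M : 'M[R]_n, chart M i j = f M.
  by rewrite (funext fE).
case: (@splitP 1 n i) => a ia; case: (@splitP 1 n j) => b jb.
- have -> : i = lshift n a by exact/val_inj.
  have -> : j = lshift n b by exact/val_inj.
  exists (fun M => 1 - \sum_j (1 - \sum_i M i j)).
    by apply: (sum_coords) => k; apply: (sum_coords) => k'; exact: is_affine_coord.
  by move=> M; rewrite [LHS]block_mxEul !mxE !ord1 eqxx mulr1n.
- have -> : i = lshift n a by exact/val_inj.
  have -> : j = rshift 1 b by exact/val_inj.
  exists (fun M => 1 - \sum_k M k b).
    by apply: (sum_coords) => k; exact: is_affine_coord.
  by move=> M; rewrite [LHS]block_mxEur mxE.
- have -> : i = rshift 1 a by exact/val_inj.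
  have -> : j = lshift n b by exact/val_inj.
  exists (fun M => 1 - \sum_k M a k).
    by apply: (sum_coords) => k; exact: is_affine_coord.
  by move=> M; rewrite [LHS]block_mxEdl mxE.
- have -> : i = rshift 1 a by exact/val_inj.
  have -> : j = rshift 1 b by exact/val_inj.
  exists (fun M => M a b); first exact: is_affine_coord.
  by move=> M; rewrite [LHS]block_mxEdr.
Qed.

(* The uniform matrix has unit line sums, so no entry vanishes identically. *)
Lemma chart_entry_neq0 i j : exists M : 'M[R]_n, chart M i j != 0.
Proof.
have n1 : (n.+1%:R : R) != 0 by rewrite pnatr_eq0.
pose J : 'M[R]_n.+1 := const_mx n.+1%:R^-1.
have J1 : unit_line_sums J.
  by split=> k; (under eq_bigr do rewrite mxE);
    rewrite sumr_const card_ord -[LHS]mulr_natr mulVf.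
exists (coords J).
by rewrite (coordsK J1) mxE invr_eq0.
Qed.

(** For a permutation matrix the minimum runs over one residual entry per row, at [(i, s i)]; each
    residual in turn comes from the previous residual and coefficient. *)
Lemma piecewise_affine_birkhoff_coef (P : nat -> 'M[R]_n.+1) (l : nat) :
  (forall k, (k <= l)%N -> is_perm_mx (P k)) ->
  piecewise_affine (fun M => birkhoff_coef P (chart M) l).
Proof.
have coef_pa k : is_perm_mx (P k) ->
    (forall i j, piecewise_affine (fun M => birkhoff_residual P (chart M) k i j)) ->
    piecewise_affine (fun M => birkhoff_coef P (chart M) k).
  move=> permP resA; have [s Ps] := is_perm_mxP _ permP.
  apply: (@piecewise_affine_min _ _ _ _
    (fun i M => birkhoff_residual P (chart M) k i (s i))) => [i|M]; first exact: resA.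
  have resE i j : birkhoff_residual P (chart M) k i j =
      chart M i j - \sum_(q < k) birkhoff_coef P (chart M) q * P q i j.
    rewrite birkhoff_residualE !mxE summxE; congr (_ - _).
    by apply: eq_bigr => q _; rewrite !mxE.
  have [[i [j [Pij cE]]] c_le] := @birkhoff_coef_min _ _ P (chart M) k permP.
  split; last by move=> i'; rewrite resE; apply: c_le; rewrite Ps !mxE eqxx.
  exists i; rewrite resE cE.
  move: Pij; rewrite Ps !mxE; case: eqP => [->//|_] /eqP.
  by rewrite eq_sym oner_eq0.
move=> permP; apply: (coef_pa l); first exact: permP.
have: (l <= l)%N by [].
(* The bound [l] stays fixed during the induction, so that [permP] applies to every earlier
   matrix. *)
elim: {1 3}l => [|k IH] kl i j; first exact/is_affine_piecewise/is_affine_chart.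
rewrite (_ : (fun _ => _) = fun M => birkhoff_residual P (chart M) k i j -
    birkhoff_coef P (chart M) k * P k i j); last first.
  by apply/funext => M; rewrite /= !mxE.
have resA := IH (ltnW kl).
by apply: piecewise_affine_subZ => //; apply: coef_pa => //; exact/permP/ltnW.
Qed.

End Chart.

(** * Almost everywhere differentiability on the polytope *)

Theorem theorem2p5 (R : realType) (n : nat) (P : nat -> 'M[R]_n.+1)
    (hP : set_bij `I_(n.+1`!)%N [set S | is_perm_mx S] P)
    (l : nat) (hl : (l < n.+1`!)%N) :
  ae_differentiable_on birkhoff_polytope (fun A => birkhoff_coef P A l).
Proof.
have permP k : (k <= l)%N -> is_perm_mx (P k).
  move=> kl; have [PI _ _] := hP; apply: (PI k) => /=; exact: leq_ltn_trans hl.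
have [s s0 sdiff] :=
  piecewise_affine_differentiable _ (piecewise_affine_birkhoff_coef P l permP).
have [g gE] := choice (fun p : 'I_n.+1 * 'I_n.+1 => @is_affine_chart R n p.1 p.2).
have g0 p : g p != 0.
  have [M] := @chart_entry_neq0 R n p.1 p.2.
  apply: contraNneq => gp; rewrite gE gp /affine_eval big1 ?addr0// => q _.
  by rewrite mxE mul0r.
(* Two kinds of exceptional zero sets: where distinct pieces of the coefficient may agree, and where
   a matrix entry vanishes. *)
pose t := s ++ [seq g p | p : 'I_n.+1 * 'I_n.+1].
apply: lebesgue_outer_null_sub (affine_zeros_seq_null t _); last first.
  rewrite mem_cat negb_or s0 /=; apply/mapP => -[p _ /eqP].
  by rewrite eq_sym (negbTE (g0 p)).
move=> M [[M_ge0 _] ndiff]; apply: contrapT => Mt.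
have M_neq0 h : h \in t -> affine_eval h M != 0.
  by move=> ht; apply/eqP => h0; apply: Mt; exists h.
apply: ndiff; rewrite /differentiable_in chartK; split; last first.
  by apply: sdiff => h hs; apply: M_neq0; rewrite mem_cat hs.
(* Off the zero sets the non-negative entries are positive at [M], hence near [M]; as they are
   finitely many, [M] is interior to the polytope in the chart. *)
have chart_gt0 (p : 'I_n.+1 * 'I_n.+1) : \forall N \near M, 0 < chart N p.1 p.2.
  suff : \forall N \near M, 0 < affine_eval (g p) N.
    by apply: filterS => N; rewrite gE.
  have /cvgr_gt : {for M, continuous (affine_eval (g p))}.
    exact: continuous_affine_eval.
  apply; rewrite lt_neqAle eq_sym M_neq0 ?mem_cat ?map_f ?orbT ?mem_enum//.
  by rewrite -gE M_ge0.
have all_gt0 : \forall N \near M, forall p : 'I_n.+1 * 'I_n.+1, 0 < chart N p.1 p.2.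
  exact: filter_forall chart_gt0.
apply: filterS all_gt0 => N N_gt0; split; last exact: chart_unit_line_sums.
by move=> i j; exact: ltW (N_gt0 (i, j)).
Qed.
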